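(* The roots of $P_n(z)$ converge uniformly to $\partial\Gamma$ and fill it densely, in the following sense: (i) $\max\{\operatorname{dist}(\zeta,\partial\Gamma):\ P_n(\zeta)=0\}\to0$ as $n\to\infty$; and (ii) for every $w\in\partial\Gamma$ and every $\varepsilon>0$ there exists $N$ such that for all $n\ge N$, $P_n(z)$ has a root within distance $\varepsilon$ of $w$.
   Context: For $0\le k\le n$ let $\mathcal{B}(n,k)=\binom{n}{\lfloor (n-k)/2\rfloor}$ and $P_n(z)=\sum_{k=0}^n\mathcal{B}(n,k)z^{n-k}$. Let $\Gamma=\{z\in\mathbb{C}:\ |z|\le1,\ \frac{|z|}{|1+z^2|}\le\frac12\}$ (equivalently, the intersection of the closed disks of radius $\sqrt2$ centered at $\pm i$), which is the limit as $n\to\infty$ of the sets $\Gamma_n=\{z:\ |z|\le1,\ |z|/(\sqrt[n]{|1+z|}\,|1+z^2|)\le \frac{n^2-1}{2n^2}\}$, and let $\partial\Gamma$ be its boundary. *)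

(* Defs.v *)
From HB Require Import structures.
From mathcomp Require Import all_boot all_order all_algebra.
From mathcomp Require Import complex.
From mathcomp Require Import all_classical all_reals all_analysis.

Set Implicit Arguments.
Unset Strict Implicit.
Unset Printing Implicit Defensive.

Import Order.TTheory GRing.Theory Num.Theory.
Import numFieldNormedType.Exports.

Local Open Scope classical_set_scope.
Local Open Scope ring_scope.

(* [complex R] does not inherit a topology from its field structure: the
   generic instances are attached to variables [K : numClosedFieldType], so the
   metric topology of [K^o] is copied here.  It is the usual topology of the
   complex plane, with the balls [`|x - y| < e].  *)
#[non_forgetful_inheritance]
HB.instance Definition _ (R : realType) := NormedModule.copy R[i] R[i]^o.

Definition boundary (T : topologicalType) (A : set T) : set T :=
  closure A `\` interior A.

(* The modulus is [Normc.normc : R[i] -> R], because the norm [`|z|] of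
   R[i] takes its values in R[i].  *)
Notation cmod := Normc.normc.

Definition Bnk (n k : nat) : nat := 'C(n, (n - k)./2).

Definition Pn (R : realType) (n : nat) : {poly R[i]} :=
  \sum_(k < n.+1) (Bnk n k)%:R *: 'X^(n - k).

(* The quotient |z| / |1 + z^2| is infinite at z = +-i, so these points are not
   in the region; they are excluded explicitly because x / 0 = 0 here.  *)
Definition Gamma (R : realType) : set R[i] :=
  [set z | [/\ cmod z <= 1, 1 + z ^+ 2 != 0 &
               cmod z / cmod (1 + z ^+ 2) <= 2^-1]].

Definition dist (R : realType) (z : R[i]) (A : set R[i]) : \bar R :=
  ereal_inf [set (cmod (z - w))%:E | w in A].

(* For n > 0 the set of roots is finite and nonempty, so the supremum is a
   maximum; [Pn R 0 = 1] has no root and the value is then -oo.  *)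
Definition max_root_dist (R : realType) (n : nat) : \bar R :=
  ereal_sup [set dist zeta (boundary (@Gamma R)) |
              zeta in [set zeta : R[i] | root (Pn R n) zeta]].

(* Main.v *)
Require Import Defs.
From HB Require Import structures.
From mathcomp Require Import all_boot all_order all_algebra.
From mathcomp Require Import complex.
From mathcomp Require Import all_classical all_reals all_analysis.
From mathcomp Require Import zify ring lra.
Import Order.TTheory GRing.Theory Num.Theory.
Import numFieldNormedType.Exports.
Local Open Scope classical_set_scope.
Local Open Scope ring_scope.

(* With [a_j = 'C(n, j./2)], [Pn n] is the truncation in degree [n] of
   [(1 + z) * (1 + z ^+ 2) ^+ n = \sum_(j < 2n+2) a_j * z ^+ j], and the rest is
   [z ^+ n.+1] times [tail_poly n z], whose coefficients decrease.  Hence for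
   [|z| <= 1] the rest is at most [2 * |2z|^n] and, away from the points 1 and
   -1, at least [|2z|^n] up to a polynomial factor in [n] (Enestrom-Kakeya).  So
   [Pn n] has the size of [max(|1 + z^2|, |2z|)^n] off the curve
   [|1 + z^2| = |2z|], whose part in the unit disk is the boundary of Gamma;
   this gives (i).
   For (ii), if [Pn n] had no root near a boundary point [w], then [log |Pn n|]
   would be harmonic there, so that its mean over the vertices of a regular
   polygon around [w] would almost be its value at [w]; this contradicts the
   kink of [max(log |1 + z^2|, log |2z|)] at [w].  *)

Set Implicit Arguments.
Unset Strict Implicit.
Unset Printing Implicit Defensive.

(** * The tail polynomial and central binomial coefficients *)

Definition tail_poly (F : nzRingType) (n : nat) (z : F) : F :=
  \sum_(i < n.+1) 'C(n, (n.+1 + i)./2)%:R * z ^+ i.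

Lemma leq_bin_upper_half n m : (n <= m.*2.+1)%N -> ('C(n, m.+1) <= 'C(n, m))%N.
Proof.
move=> le_nm; rewrite -(leq_pmul2l (ltn0Sn m)) mul_bin_left leq_mul2r.
by apply/orP; right; lia.
Qed.

Lemma leq_bin_half n m : ('C(n, m) <= 'C(n, n.+1./2))%N.
Proof.
have up k : ('C(n, n.+1./2 + k) <= 'C(n, n.+1./2))%N.
  elim: k => [|k IHk]; first by rewrite addn0.
  by rewrite addnS (leq_trans _ IHk)// leq_bin_upper_half//; lia.
have [le_hm|lt_mh] := leqP n.+1./2 m; first by rewrite -(subnKC le_hm).
have le_mn : (m <= n)%N by lia.
rewrite -bin_sub//; have [le_hm|lt_mh'] := leqP n.+1./2 (n - m).
  by rewrite -(subnKC le_hm).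
by have -> : (n - m = n.+1./2.-1)%N; lia.
Qed.

Lemma leq_exp2_bin_half n : (2 ^ n <= n.+1 * 'C(n, n.+1./2))%N.
Proof.
rewrite -[2%N]/(1 + 1)%N expnDn -[X in (X * _)%N]card_ord -sum_nat_const.
by apply: leq_sum => i _; rewrite !exp1n !muln1 leq_bin_half.
Qed.

(** With [h = n.+1./2], the ratio of consecutive coefficients is [(n - h) / (h + 1)]; as [n <= 2h],
    the gap is at least ['C(n, h) / (h + 1)]. *)
Lemma bin_half_gap n :
  ('C(n, n.+1./2) <= n.+1 * ('C(n, n.+1./2) - 'C(n, n.+1./2.+1)))%N.
Proof.
set h := n.+1./2.
have := mul_bin_left n h.
have H : ('C(n, h.+1) <= 'C(n, h))%N by rewrite leq_bin_upper_half /h; lia.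
have : (n <= h.*2)%N by rewrite /h; lia.
have : (h <= n)%N by rewrite /h; lia.
move: ('C(n, h)) ('C(n, h.+1)) H => a b; move: h => h.
case: n => [|n] le_ba le_hn le_nh E; first nia.
nia.
Qed.

Lemma big_ord_double (V : nmodType) (F : nat -> V) m :
  \sum_(j < m.*2) F j = \sum_(i < m) (F i.*2 + F i.*2.+1).
Proof.
elim: m => [|m IHm]; first by rewrite !big_ord0.
by rewrite doubleS 2!big_ord_recr/= IHm big_ord_recr/= addrA.
Qed.

(** * Splitting [(1 + z) * (1 + z ^+ 2) ^+ n] *)

Section Splitting.
Variable R : realType.
Implicit Types z : R[i].

Lemma horner_Pn n z :
  (Pn R n).[z] = \sum_(j < n.+1) 'C(n, j./2)%:R * z ^+ j.
Proof.
rewrite /Pn (reindex_inj rev_ord_inj) horner_sum.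
apply: eq_bigr => -[j lt_jn] _.
by rewrite hornerZ hornerXn /Bnk /= subSS subKn.
Qed.

Lemma Pn_tail n z :
  (Pn R n).[z] + z ^+ n.+1 * tail_poly n z = (1 + z) * (1 + z ^+ 2) ^+ n.
Proof.
have -> : (1 + z) * (1 + z ^+ 2) ^+ n =
    \sum_(j < n.+1.*2) 'C(n, j./2)%:R * z ^+ j.
  rewrite (big_ord_double (fun j => 'C(n, j./2)%:R * z ^+ j)) exprDn mulr_sumr.
  apply: eq_bigr => i _; rewrite /= doubleK uphalf_double expr1n mul1r -exprM.
  by rewrite mul2n -mulr_natl exprS; ring.
rewrite -addnn big_split_ord/= horner_Pn; congr (_ + _).
by rewrite mulr_sumr; apply: eq_bigr => i _; rewrite mulrCA exprD.
Qed.

(** By the symmetry of binomial coefficients the tail is the reversal of [Pn], so its estimates in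
    the unit disk also control [Pn] outside. *)
Lemma Pn_inv n z : z != 0 -> (Pn R n).[z] = z ^+ n * tail_poly n z^-1.
Proof.
move=> z0; rewrite horner_Pn (reindex_inj rev_ord_inj) mulr_sumr.
apply: eq_bigr => -[j lt_jn] _ /=; rewrite subSS mulrCA exprVn.
rewrite -expfB_cond; last by rewrite (negPf z0).
congr (_%:R * _); rewrite -bin_sub; last by lia.
by congr 'C(_, _); lia.
Qed.

End Splitting.

(** * Growth, modulus and the tail polynomial *)

Section Growth.
Variable R : realType.

(** Bernoulli's inequality. *)
Lemma ler_nat_geometric (h : R) n : 0 <= h -> 1 + n%:R * h <= (1 + h) ^+ n.
Proof.
move=> h0; elim: n => [|n IHn]; first by rewrite mul0r addr0 expr0.
rewrite exprS; have := ler_wpM2l (addr_ge0 ler01 h0) IHn.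
apply: le_trans; rewrite -natr1.
have : 0 <= n%:R * (h * h) by rewrite !mulr_ge0.
nra.
Qed.

(** Induction on [k] with [q = p * p]: one factor [p ^+ n] absorbs the constant and the power [k],
    the other absorbs one more [n.+1%:R]. *)
Lemma polynomial_le_geometric (q K : R) k : 1 < q ->
  exists N, forall n, (N <= n)%N -> K * n.+1%:R ^+ k <= q ^+ n.
Proof.
elim: k K q => [|k IHk] K q q1.
  have h0 : 0 < q - 1 by rewrite subr_gt0.
  exists (Num.bound `|K / (q - 1)|) => n le_Nn; rewrite expr0 mulr1.
  have := ler_nat_geometric n (ltW h0).
  rewrite [1 + (q - 1)]addrC subrK; apply: le_trans.
  have : K / (q - 1) <= n%:R.
    apply: le_trans (ler_norm _) _.
    by rewrite (le_trans (ltW (archi_boundP (normr_ge0 _))))// ler_nat.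
  by rewrite ler_pdivrMr//; lra.
have q0 : 0 < q by lra.
have p1 : 1 < Num.sqrt q by rewrite -[X in X < _]sqrtr1 ltr_sqrt.
set p := Num.sqrt q in p1; have pp : q = p * p by rewrite -expr2 sqr_sqrtr ?ltW.
pose h := Num.min 1 (p - 1).
have h0 : 0 < h by rewrite lt_min ltr01 subr_gt0.
have [h1 hp] : h <= 1 /\ h <= p - 1 by rewrite !ge_min !lexx orbT.
have [N HN] := IHk (`|K| / h) p p1.
exists N => n /HN leP; rewrite pp exprMn.
have le_h : n.+1%:R * h <= p ^+ n.
  have p0 : 0 <= p - 1 by lra.
  have := ler_nat_geometric n p0; rewrite [1 + (p - 1)]addrC subrK.
  apply: le_trans; rewrite -natr1 mulrDl mul1r addrC lerD//.
  by rewrite ler_wpM2l.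
apply: le_trans (_ : `|K| * n.+1%:R ^+ k.+1 <= _).
  by rewrite ler_wpM2r ?ler_norm ?exprn_ge0.
have -> : `|K| * n.+1%:R ^+ k.+1 = `|K| / h * n.+1%:R ^+ k * (n.+1%:R * h).
  by rewrite exprS; field; rewrite gt_eqF.
apply: ler_pM => //.
  by rewrite !mulr_ge0 ?invr_ge0 ?exprn_ge0// ltW.
by rewrite mulr_ge0// ltW.
Qed.

Lemma geometric_le_geometric (A B K : R) k : 0 <= A -> A < B ->
  exists N, forall n, (N <= n)%N -> K * n.+1%:R ^+ k * A ^+ n <= B ^+ n.
Proof.
rewrite le_eqVlt => /predU1P[<- B0|A0 AB].
  exists 1%N => -[//|n] _; rewrite expr0n mulr0 exprn_ge0//.
  exact: ltW.
have [|N HN] := @polynomial_le_geometric (B / A) K k.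
  by rewrite ltr_pdivlMr// mul1r.
by exists N => n /HN; rewrite expr_div_n ler_pdivlMr// exprn_gt0.
Qed.

End Growth.

(** * Real and imaginary parts, and the modulus *)

Section Modulus.
Variable R : realType.
Implicit Types z w : R[i].

Lemma complex_ReD z w : complex.Re (z + w) = complex.Re z + complex.Re w.
Proof. by case: z w => [? ?] [? ?]. Qed.

Lemma complex_ImD z w : complex.Im (z + w) = complex.Im z + complex.Im w.
Proof. by case: z w => [? ?] [? ?]. Qed.

Lemma complex_ReN z : complex.Re (- z) = - complex.Re z.
Proof. by case: z. Qed.

Lemma complex_ImN z : complex.Im (- z) = - complex.Im z.
Proof. by case: z. Qed.

Lemma complex_ReM z w : complex.Re (z * w) =
  complex.Re z * complex.Re w - complex.Im z * complex.Im w.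
Proof. by case: z w => [? ?] [? ?]. Qed.

Lemma complex_ImM z w : complex.Im (z * w) =
  complex.Re z * complex.Im w + complex.Im z * complex.Re w.
Proof. by case: z w => [? ?] [? ?]. Qed.

Lemma complex_Re1 : complex.Re (1 : R[i]) = 1. Proof. by []. Qed.

Lemma complex_Im1 : complex.Im (1 : R[i]) = 0. Proof. by []. Qed.

Definition reimE := (complex_ReD, complex_ImD, complex_ReN, complex_ImN,
  complex_ReM, complex_ImM, complex_Re1, complex_Im1).

Lemma complex_Re_nat n : complex.Re (n%:R : R[i]) = n%:R.
Proof. by elim: n => // n IHn; rewrite -!natr1 complex_ReD IHn. Qed.

Lemma complex_Im_nat n : complex.Im (n%:R : R[i]) = 0.
Proof. by elim: n => // n IHn; rewrite -!natr1 complex_ImD IHn addr0. Qed.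

Lemma complex_Re_natM n z : complex.Re (n%:R * z) = n%:R * complex.Re z.
Proof. by rewrite complex_ReM complex_Re_nat complex_Im_nat mul0r subr0. Qed.

Lemma complex_Re_sum (I : Type) (r : seq I) (F : I -> R[i]) :
  complex.Re (\sum_(i <- r) F i) = \sum_(i <- r) complex.Re (F i).
Proof. by elim/big_rec2: _ => // i x y _ <-; rewrite complex_ReD. Qed.

Lemma cmod_sqr z : cmod z ^+ 2 = complex.Re z ^+ 2 + complex.Im z ^+ 2.
Proof. by case: z => x y /=; rewrite sqr_sqrtr ?addr_ge0 ?sqr_ge0. Qed.

Lemma cmod_ge0 z : 0 <= cmod z.
Proof. by case: z => x y; rewrite sqrtr_ge0. Qed.

Lemma cmodE z : (cmod z)%:C%C = `|z|.
Proof. by rewrite normc_def; case: z. Qed.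

Lemma cmod0 : cmod (0 : R[i]) = 0. Proof. exact: Normc.normc0. Qed.

Lemma cmod1 : cmod (1 : R[i]) = 1. Proof. exact: Normc.normc1. Qed.

Lemma cmod_eq0 z : (cmod z == 0) = (z == 0).
Proof. by apply/eqP/eqP => [/Normc.eq0_normc//|->]; rewrite cmod0. Qed.

Lemma cmod_gt0 z : (0 < cmod z) = (z != 0).
Proof. by rewrite lt_neqAle cmod_ge0 andbT eq_sym cmod_eq0. Qed.

Lemma cmodM z w : cmod (z * w) = cmod z * cmod w.
Proof. exact: Normc.normcM. Qed.

Lemma cmodX z n : cmod (z ^+ n) = cmod z ^+ n.
Proof.
by elim: n => [|n IHn]; rewrite ?expr0 ?cmod1// !exprS cmodM IHn.
Qed.

Lemma cmodN z : cmod (- z) = cmod z.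
Proof. by case: z => x y /=; rewrite !sqrrN. Qed.

Lemma cmod_leD z w : cmod (z + w) <= cmod z + cmod w.
Proof. exact: le_normcD. Qed.

Lemma cmod_leB z w : cmod z - cmod w <= cmod (z + w).
Proof. by rewrite lerBlDr -(cmodN w) (le_trans _ (cmod_leD _ _))// addrK. Qed.

Lemma cmod_distC z w : cmod (z - w) = cmod (w - z).
Proof. by rewrite -cmodN opprB. Qed.

Lemma cmod_sum (I : Type) (r : seq I) (F : I -> R[i]) :
  cmod (\sum_(i <- r) F i) <= \sum_(i <- r) cmod (F i).
Proof.
elim/big_rec2: _ => [|i x y _ le_yx]; first by rewrite cmod0.
by rewrite (le_trans (cmod_leD _ _))// lerD2l.
Qed.

Lemma cmod_prod (I : Type) (r : seq I) (F : I -> R[i]) :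
  cmod (\prod_(i <- r) F i) = \prod_(i <- r) cmod (F i).
Proof. by elim/big_rec2: _ => [|i x y _ <-]; rewrite ?cmod1 ?cmodM. Qed.

Lemma cmod_nat n : cmod (n%:R : R[i]) = n%:R.
Proof.
apply/eqP; rewrite -(eqrXn2 (n := 2)) ?cmod_ge0// cmod_sqr.
by rewrite complex_Re_nat complex_Im_nat expr0n addr0.
Qed.

Lemma Re_le_cmod z : complex.Re z <= cmod z.
Proof.
apply: le_trans (ler_norm _) _.
rewrite -(ler_pXn2r (n := 2)) ?nnegrE ?cmod_ge0//.
by rewrite cmod_sqr real_normK ?num_real// lerDl sqr_ge0.
Qed.

(** Turns a lower bound on the distance from 1 into the real part bound required by
    [cmod_tail_ge]. *)
Lemma sqr_cmod_1B_le z : cmod z <= 1 ->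
  cmod (1 - z) ^+ 2 <= 2 * (1 - complex.Re z).
Proof.
move=> z1; have := cmod_ge0 z; have := cmod_sqr z.
rewrite (cmod_sqr (1 - z)) !reimE.
nra.
Qed.

End Modulus.

(** * Upper and lower bounds for the tail polynomial *)

Section TailEstimates.
Variable R : realType.
Implicit Types z : R[i].

(** The form with [1 - z ^+ i.+1] gives every term a nonnegative real part when [b] is nonnegative
    and decreasing and [|z| <= 1]. *)
Lemma summation_by_parts (b : nat -> R[i]) z m :
  (1 - z) * (\sum_(i < m) b i * z ^+ i) =
  \sum_(i < m) (b i - b i.+1) * (1 - z ^+ i.+1) + b m * (1 - z ^+ m).
Proof.
elim: m => [|m IHm]; first by rewrite !big_ord0 expr0 mulr0 subrr mulr0 addr0.
by rewrite !big_ord_recr/= mulrDr IHm !exprS; ring.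
Qed.

(** The tail coefficients are among those of [(1 + z) * (1 + z ^+ 2) ^+ n], whose value at 1 is
    [2 ^+ n.+1]. *)
Lemma cmod_tail_le n z : cmod z <= 1 -> cmod (tail_poly n z) <= 2 ^+ n.+1.
Proof.
move=> z1; rewrite /tail_poly (le_trans (cmod_sum _ _))//.
have tot : \sum_(j < n.+1.*2) 'C(n, j./2)%:R = 2 ^+ n.+1 :> R.
  rewrite (big_ord_double (fun j => 'C(n, j./2)%:R)) exprS -[in RHS]natr1.
  rewrite addrC exprDn mulr_sumr.
  apply: eq_bigr => i _; rewrite /= doubleK uphalf_double !expr1n mulr1.
  by rewrite mulrDl !mul1r.
rewrite -tot -addnn big_split_ord/=.
apply: le_trans (_ : \sum_(i < n.+1) 'C(n, (n.+1 + i)./2)%:R <= _).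
  apply: ler_sum => i _; rewrite cmodM cmod_nat cmodX ler_piMr//.
  by rewrite exprn_ile1// cmod_ge0.
by rewrite lerDr sumr_ge0.
Qed.

(* By summation by parts [(1 - z) * tail_poly n z] is a combination with
   nonnegative coefficients of the [1 - z ^+ i.+1], which all have nonnegative
   real part; the first two of these terms are enough.  *)
Lemma cmod_tail_ge n z (D : R) : (0 < n)%N -> cmod z <= 1 ->
  D <= 1 - complex.Re z -> D <= 1 - complex.Re (z ^+ 2) ->
  2 ^+ n * D <= n.+1%:R ^+ 2 * cmod ((1 - z) * tail_poly n z).
Proof.
case: n => // n _ z1 Dz Dz2.
have [D0|D0] := ltP D 0.
  rewrite (@le_trans _ _ 0)//; last by rewrite mulr_ge0 ?cmod_ge0 ?exprn_ge0.
  by rewrite mulr_ge0_le0 ?exprn_ge0// ltW.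
pose c i := 'C(n.+1, (n.+2 + i)./2).
have cS i : (c i.+1 <= c i)%N.
  rewrite /c addnS; case: (boolP (odd (n.+2 + i))) => odd_i; last first.
    by have -> // : ((n.+2 + i).+1./2 = (n.+2 + i)./2)%N by lia.
  have -> : ((n.+2 + i).+1./2 = (n.+2 + i)./2.+1)%N by lia.
  by rewrite leq_bin_upper_half//; lia.
(* The sum telescopes to the gap between the two central coefficients; [bin_half_gap] and
   [leq_exp2_bin_half] each cost a factor [n.+2]. *)
have gap : (2 ^ n.+1 <= n.+2 ^ 2 * ((c 0 - c 1) + (c 1 - c 2)))%N.
  have := leq_exp2_bin_half n.+1; have := bin_half_gap n.+1.
  have := cS 0%N; have := cS 1%N; rewrite /c addn0 addn2.
  have -> : (n.+4./2 = n.+2./2.+1)%N by lia.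
  move: 'C(_, n.+2./2) 'C(_, (n.+2 + 1)./2) 'C(_, n.+2./2.+1) => u v w.
  move=> wv vu; have -> : (u - v + (v - w) = u - w)%N by lia.
  nia.
pose d i : R := (c i - c i.+1)%:R.
have Re_pow i : complex.Re (z ^+ i) <= 1.
  by rewrite (le_trans (Re_le_cmod _))// cmodX exprn_ile1 ?cmod_ge0.
have -> : (1 - z) * tail_poly n.+1 z =
    \sum_(i < n.+2) (c i - c i.+1)%:R * (1 - z ^+ i.+1).
  rewrite (summation_by_parts (fun i => 'C(n.+1, (n.+2 + i)./2)%:R)).
  rewrite [X in _ + X * _](_ : _ = 0) ?mul0r ?addr0; last first.
    by rewrite addnn doubleK bin_small.
  by apply: eq_bigr => i _; rewrite natrB.
apply: le_trans (_ : n.+2%:R ^+ 2 * ((d 0 + d 1) * D) <= _); last first.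
  rewrite ler_wpM2l ?exprn_ge0// (le_trans _ (Re_le_cmod _))// complex_Re_sum.
  rewrite 2!big_ord_recl addrA -[leLHS]addr0 lerD//; last first.
    apply: sumr_ge0 => i _; rewrite complex_Re_natM.
    by rewrite mulr_ge0// complex_ReD complex_ReN complex_Re1 subr_ge0 Re_pow.
  rewrite mulrDl lerD// complex_Re_natM ler_wpM2l//
    complex_ReD complex_ReN complex_Re1//.
rewrite mulrA ler_wpM2r// -natrX -natrD -natrX -natrM ler_nat.
exact: gap.
Qed.

End TailEstimates.

(** * The lens and the size of [Pn] *)

Section UniformGrowth.
Variable R : realType.

(** [N] is chosen before [a] and [b], because the roots at which this is applied move with [n]. *)
Lemma geometric_gap (d K : R) k : 0 < d ->
  exists N, forall n, (N <= n)%N -> forall a b : R,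
  0 <= a -> a * (1 + d) <= b -> K * n.+1%:R ^+ k * a ^+ n <= b ^+ n.
Proof.
move=> d0; have [|N HN] := @polynomial_le_geometric R (1 + d) K k; first lra.
exists N => n /HN le_n a b a0 le_ab.
apply: le_trans (_ : (a * (1 + d)) ^+ n <= _).
  by rewrite exprMn mulrC ler_wpM2l ?exprn_ge0.
by rewrite lerXn2r ?nnegrE ?mulr_ge0 ?(le_trans _ le_ab)//; nra.
Qed.

End UniformGrowth.

(** * The lens as a sign condition *)

Section Lens.
Variable R : realType.
Implicit Types z w : R[i].

(** This is 2 minus the larger of [|z - i|^2] and [|z + i|^2]: nonnegative exactly on the
    intersection of the disks of radius [sqrt 2] around [i] and [-i]. *)
Definition lens z : R := 1 - cmod z ^+ 2 - 2 * `|complex.Im z|.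

(** The left side equals [(1 - |z|^2)^2 - 4 (Im z)^2], a difference of squares. *)
Lemma lens_factor z : cmod (1 + z ^+ 2) ^+ 2 - (2 * cmod z) ^+ 2 =
  lens z * (1 - cmod z ^+ 2 + 2 * `|complex.Im z|).
Proof.
have := real_normK (num_real (complex.Im z)).
rewrite /lens exprMn !cmod_sqr (expr2 z) !reimE; move: `|_| => Y e.
move: (complex.Re z) (complex.Im z) e => x y e.
have -> : (1 - (x ^+ 2 + y ^+ 2) - 2 * Y) * (1 - (x ^+ 2 + y ^+ 2) + 2 * Y) =
  (1 - (x ^+ 2 + y ^+ 2)) ^+ 2 - 4 * Y ^+ 2 by ring.
by rewrite e; ring.
Qed.

(** Makes the difference in [lens_factor] at least [lens z ^+ 2] in absolute value. *)
Lemma lens_cofactor z : cmod z <= 1 ->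
  `|lens z| <= 1 - cmod z ^+ 2 + 2 * `|complex.Im z|.
Proof.
move=> z1; have := cmod_ge0 z; have := normr_ge0 (complex.Im z).
by rewrite /lens ler_norml => *; apply/andP; split; nra.
Qed.

Lemma lens_ge0_cmod z : 0 <= lens z -> cmod z <= 1.
Proof.
have := cmod_ge0 z; have := normr_ge0 (complex.Im z); rewrite /lens => *; nra.
Qed.

Lemma lens_gt0E z : cmod z <= 1 ->
  (0 < lens z) = (2 * cmod z < cmod (1 + z ^+ 2)).
Proof.
move=> z1; have := lens_factor z; have := lens_cofactor z1.
have := cmod_ge0 z; have := cmod_ge0 (1 + z ^+ 2).
set s := 1 - _ + _; move: (lens z) s (cmod (1 + _)) => t s A A0 B0.
rewrite ler_norml => /andP[s1 s2] E; apply/idP/idP => H; nra.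
Qed.

Lemma lens_lt0E z : cmod z <= 1 ->
  (lens z < 0) = (cmod (1 + z ^+ 2) < 2 * cmod z).
Proof.
move=> z1; have := lens_factor z; have := lens_cofactor z1.
have := cmod_ge0 z; have := cmod_ge0 (1 + z ^+ 2).
set s := 1 - _ + _; move: (lens z) s (cmod (1 + _)) => t s A A0 B0.
rewrite ler_norml => /andP[s1 s2] E; apply/idP/idP => H; nra.
Qed.

Lemma lens1 : lens 1 = 0.
Proof. by rewrite /lens cmod1 complex_Im1 normr0 mulr0; lra. Qed.

Lemma lensN1 : lens (- 1) = 0.
Proof.
by rewrite /lens cmodN cmod1 complex_ImN complex_Im1 oppr0 normr0 mulr0; lra.
Qed.

(** Moves [z] vertically: above the abscissa [x] the curve has height [s - 1] with
    [s = sqrt(2 - x^2)], and [lens z = (s - 1 - |y|) (s + 1 + |y|)], where the second factor is at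
    least 1. *)
Lemma lens_near z : cmod z <= 1 ->
  exists w, [/\ lens w = 0, complex.Re w = complex.Re z &
              cmod (z - w) <= `|lens z|].
Proof.
case: z => x y z1.
have x1 : x ^+ 2 <= 1.
  have := exprn_ile1 2 (cmod_ge0 _) z1; rewrite cmod_sqr /=.
  by have := sqr_ge0 y; lra.
set s := Num.sqrt (2 - x ^+ 2).
have s0 : 0 <= s by rewrite sqrtr_ge0.
have ss : s ^+ 2 = 2 - x ^+ 2 by rewrite sqr_sqrtr//; lra.
have s1 : 1 <= s by nra.
pose v := if 0 <= y then s - 1 else 1 - s.
have vs : `|v| = s - 1.
  by rewrite /v; case: ifP => _; rewrite ?[`|1 - s|]distrC ger0_norm//; lra.
have vy : `|y - v| = `|s - 1 - `|y| |.
  rewrite /v; case: ifPn => [y0|]; first by rewrite (ger0_norm y0) distrC.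
  by rewrite -ltNge => y0; rewrite (ltr0_norm y0); congr `|_|; lra.
exists (x +i* v)%C; split=> //.
  rewrite /lens cmod_sqr /= vs -[v ^+ 2]real_normK ?num_real// vs.
  by rewrite (_ : x ^+ 2 = 2 - s ^+ 2); [ring|lra].
have -> : cmod ((x +i* y) - (x +i* v))%C = `|y - v|.
  by rewrite /= subrr expr0n add0r sqrtr_sqr.
rewrite vy /lens cmod_sqr /= -[y ^+ 2]real_normK ?num_real//.
have y0 := normr_ge0 y; move: `|y| y0 => Y Y0.
have -> : 1 - (x ^+ 2 + Y ^+ 2) - 2 * Y = (s - 1 - Y) * (s + 1 + Y) by nra.
by rewrite normrM ler_peMr// ger0_norm; lra.
Qed.

End Lens.

(** * Bounds for [Pn] in the unit disk *)

Section PnEstimates.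
Variable R : realType.
Implicit Types z : R[i].

Lemma sqr_cmod_le z : cmod z <= 1 -> cmod (z ^+ 2) <= 1.
Proof. by move=> z1; rewrite cmodX exprn_ile1 ?cmod_ge0. Qed.

Lemma cmod_Pn_sub n z : cmod z <= 1 ->
  cmod (z ^+ n.+1 * tail_poly n z) <= 2 * (2 * cmod z) ^+ n.
Proof.
move=> z1; rewrite cmodM cmodX.
apply: le_trans (_ : cmod z ^+ n.+1 * 2 ^+ n.+1 <= _).
  by rewrite ler_wpM2l ?exprn_ge0 ?cmod_ge0 ?cmod_tail_le.
rewrite -exprMn [cmod z * 2]mulrC exprS ler_wpM2r//.
  by rewrite exprn_ge0 ?mulr_ge0 ?cmod_ge0.
lra.
Qed.

Lemma cmod_1D_le2 z : cmod z <= 1 -> cmod (1 + z) <= 2.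
Proof. by move=> z1; rewrite (le_trans (cmod_leD _ _))// cmod1; lra. Qed.

Lemma cmod_Pn_ub n z : cmod z <= 1 ->
  cmod (Pn R n).[z] <= 2 * cmod (1 + z ^+ 2) ^+ n + 2 * (2 * cmod z) ^+ n.
Proof.
move=> z1; have := Pn_tail n z => /(canRL (addrK _)) ->.
rewrite (le_trans (cmod_leD _ _))// cmodN lerD ?cmod_Pn_sub//.
by rewrite cmodM cmodX ler_wpM2r ?cmod_1D_le2// exprn_ge0 ?cmod_ge0.
Qed.

Lemma cmod_Pn_lb_inner n z : cmod z <= 1 ->
  cmod (1 + z) * cmod (1 + z ^+ 2) ^+ n <=
  cmod (Pn R n).[z] + 2 * (2 * cmod z) ^+ n.
Proof.
move=> z1; rewrite -cmodX -cmodM -Pn_tail.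
by rewrite (le_trans (cmod_leD _ _))// lerD2l cmod_Pn_sub.
Qed.

(** Combines [cmod_tail_ge] with [Pn_tail] multiplied by [1 - z]; the bounds on [D] become real part
    bounds at [z] and [z ^+ 2] by [sqr_cmod_1B_le]. *)
Lemma cmod_Pn_lb_outer n z (D : R) : (0 < n)%N -> cmod z <= 1 ->
  2 * D <= cmod (1 - z) ^+ 2 -> 2 * D <= cmod (1 - z ^+ 2) ^+ 2 ->
  cmod z * D * (2 * cmod z) ^+ n <=
  n.+1%:R ^+ 2 * (2 * cmod (Pn R n).[z] + 4 * cmod (1 + z ^+ 2) ^+ n).
Proof.
move=> n0 z1 D1 D2.
have H1 := sqr_cmod_1B_le z1; have H2 := sqr_cmod_1B_le (sqr_cmod_le z1).
have {H1 H2}H : 2 ^+ n * D <=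
    n.+1%:R ^+ 2 * cmod ((1 - z) * tail_poly n z).
  by apply: cmod_tail_ge => //; lra.
apply: le_trans (_ : cmod z ^+ n.+1 *
  (n.+1%:R ^+ 2 * cmod ((1 - z) * tail_poly n z)) <= _).
  rewrite (le_trans _ (ler_wpM2l _ H)) ?exprn_ge0 ?cmod_ge0//.
  by rewrite exprMn exprS le_eqVlt; apply/orP; left; apply/eqP; ring.
rewrite mulrCA ler_wpM2l ?exprn_ge0// -cmodX -cmodM mulrCA cmodM.
have -> : z ^+ n.+1 * tail_poly n z =
    (1 + z) * (1 + z ^+ 2) ^+ n + - (Pn R n).[z].
  by rewrite -Pn_tail addrC addKr.
apply: le_trans (_ : 2 * (2 * cmod (1 + z ^+ 2) ^+ n + cmod (Pn R n).[z]) <= _).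
  apply: ler_pM; rewrite ?cmod_ge0//; last first.
    rewrite (le_trans (cmod_leD _ _))// cmodN lerD2r cmodM cmodX.
    by rewrite ler_wpM2r ?exprn_ge0 ?cmod_ge0 ?cmod_1D_le2.
  by rewrite cmod_1D_le2// cmodN.
lra.
Qed.

(** Enestrom-Kakeya: a root outside the disk would make the tail vanish at [z^-1], where
    [cmod_tail_ge] with [D > 0] keeps it nonzero. *)
Lemma root_Pn_le1 n z : root (Pn R n) z -> cmod z <= 1.
Proof.
rewrite leNgt => /rootP Pz; apply/negP => z1.
have z0 : z != 0 by rewrite -cmod_gt0; lra.
case: n Pz => [|n Pz].
  by rewrite horner_Pn big_ord1 expr0 mulr1 => /eqP; rewrite oner_eq0.
have y1 : cmod z^-1 < 1 by rewrite Normc.normcV invf_lt1//; lra.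
have y2 : cmod (z^-1 ^+ 2) < 1.
  by rewrite cmodX expr_lt1 ?cmod_ge0.
pose D := Num.min (1 - complex.Re z^-1) (1 - complex.Re (z^-1 ^+ 2)).
have D0 : 0 < D.
  by rewrite lt_min !subr_gt0 !(le_lt_trans (Re_le_cmod _)).
have := cmod_tail_ge (D := D) (ltn0Sn n) (ltW y1).
rewrite !ge_min !lexx orbT => /(_ isT isT).
have -> : tail_poly n.+1 z^-1 = 0.
  by move/eqP: Pz; rewrite Pn_inv// mulf_eq0 expf_eq0/= (negPf z0) => /eqP.
rewrite mulr0 cmod0 mulr0 leNgt => /negP; apply.
by rewrite mulr_gt0 ?exprn_gt0.
Qed.

End PnEstimates.

(** * Location of the roots *)

Section RootLocation.
Variable R : realType.
Implicit Types z : R[i].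

Lemma exists_double_le (x y : R) : 0 < x -> 0 < y ->
  exists2 D, 0 < D & 2 * D <= x /\ 2 * D <= y.
Proof.
move=> x0 y0; exists (Num.min x y / 2); first by rewrite divr_gt0// lt_min x0.
by rewrite [2 * _]mulrC divfK// !ge_min !lexx orbT.
Qed.

(** From [a + b <= 4] follows [b - a >= e^2 / 4] (when [a <= b]), and [a <= 2] makes this at least
    [a * e^2 / 8]. *)
Lemma gap_of_sqr_gap (a b e : R) : 0 <= a <= 2 -> 0 <= b <= 2 ->
  e ^+ 2 <= b ^+ 2 - a ^+ 2 -> a * (1 + e ^+ 2 / 8) <= b.
Proof.
move=> /andP[a0 a2] /andP[b0 b2]; have := sqr_ge0 e.
move: (e ^+ 2) => e2 e2_ge0 le_e2.
have [lt_ba|le_ab] := ltP b a; first by nra.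
have : e2 <= 4 * (b - a) by nra.
nra.
Qed.

(** If [|lens z| > e], one of [|1 + z^2|] and [2|z|] exceeds the other by a fixed ratio, and its
    n-th power prevents [Pn] from vanishing. The corners 1 and -1 are cut out because the lower
    bounds degenerate there. *)
Lemma root_Pn_lens (e : R) : 0 < e ->
  exists N, forall n, (N <= n)%N -> forall z, root (Pn R n) z ->
  e <= cmod (1 - z) -> e <= cmod (1 + z) -> `|lens z| <= e.
Proof.
move=> e0.
have [D D0 [D1 D2]] :=
  exists_double_le (exprn_gt0 2 e0) (exprn_gt0 2 (mulr_gt0 e0 e0)).
have d0 : 0 < e ^+ 2 / 8 by rewrite divr_gt0 ?exprn_gt0.
(* At a root the inner and outer bounds leave the factors [2 / e] and [8 / (e * D)]; the constants 3
   and 10 exceed them. *)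
have [N1 HN1] := geometric_gap (3 / e) 0 d0.
have [N2 HN2] := geometric_gap (10 / (e * D)) 2 d0.
exists (maxn 1 (maxn N1 N2)) => n; rewrite !geq_max => /and3P[n0 n1 n2].
move=> z Pz ez1 ez2.
have z1 := root_Pn_le1 Pz; move/rootP: Pz => Pz.
have := lens_factor z; have := lens_cofactor z1.
have := cmod_Pn_lb_inner n z1; rewrite Pz cmod0 add0r.
have : cmod z * D * (2 * cmod z) ^+ n <=
    n.+1%:R ^+ 2 * (2 * cmod (Pn R n).[z] + 4 * cmod (1 + z ^+ 2) ^+ n).
  apply: cmod_Pn_lb_outer => //.
    by rewrite (le_trans D1)// lerXn2r ?nnegrE ?cmod_ge0 ?(ltW e0).
  rewrite (le_trans D2)// lerXn2r ?nnegrE ?cmod_ge0 ?mulr_ge0 ?(ltW e0)//.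
  have -> : 1 - z ^+ 2 = (1 - z) * (1 + z) by ring.
  by rewrite cmodM ler_pM ?(ltW e0).
rewrite Pz cmod0 mulr0 add0r.
have A2 : cmod (1 + z ^+ 2) <= 2 by apply: cmod_1D_le2; exact: sqr_cmod_le.
have A0 := cmod_ge0 (1 + z ^+ 2); have B0 := cmod_ge0 z.
set s := 1 - _ + _; move: (lens z) s ez2 A2 A0 => t s ez2 A2 A0.
move: (cmod (1 + z ^+ 2)) (cmod (1 + z)) A2 A0 ez2 => A c A2 A0 ez2.
move: (cmod z) z1 B0 => r r1 r0 outer inner.
rewrite ler_norml => /andP[s1 s2] E.
rewrite leNgt; apply/negP; rewrite ltr_normr => /orP[t_gt|t_lt].
  have e2 : e ^+ 2 <= A ^+ 2 - (2 * r) ^+ 2 by nra.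
  have gap : 2 * r * (1 + e ^+ 2 / 8) <= A by apply: gap_of_sqr_gap => //; lra.
  have A_gt0 : 0 < A by nra.
  have := HN1 n n1 _ _ (mulr_ge0 (ler0n _ 2) r0) gap; rewrite expr0 mulr1.
  have := exprn_gt0 n A_gt0.
  have : 0 <= (2 * r) ^+ n by rewrite exprn_ge0 ?mulr_ge0.
  move: (A ^+ n) ((2 * r) ^+ n) inner => An Bn inner Bn0 An0.
  rewrite mulrAC ler_pdivrMr// => H.
  have : e * An <= c * An by rewrite ler_wpM2r// ltW.
  have : 0 < e * An by rewrite mulr_gt0.
  lra.
have e2 : e ^+ 2 <= (2 * r) ^+ 2 - A ^+ 2 by nra.
have gap : A * (1 + e ^+ 2 / 8) <= 2 * r by apply: gap_of_sqr_gap => //; lra.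
have r_ge : e <= 2 * r by nra.
have := HN2 n n2 _ _ A0 gap; rewrite -[leLHS]mulrA.
have B_gt0 : 0 < (2 * r) ^+ n by rewrite exprn_gt0//; lra.
have : 0 <= n.+1%:R ^+ 2 * A ^+ n by rewrite mulr_ge0 ?exprn_ge0.
move: outer; rewrite [X in _ <= X]mulrCA.
move: (_ * A ^+ n) ((2 * r) ^+ n) B_gt0 => X Bn Bn0 outer X0.
rewrite mulrAC ler_pdivrMr ?mulr_gt0// => H.
have : e * D * Bn <= 2 * (r * D * Bn).
  by rewrite 2!mulrA ler_wpM2r ?(ltW Bn0)// ler_wpM2r ?(ltW D0).
have : 0 < e * D * Bn by rewrite !mulr_gt0.
lra.
Qed.

(** Inside the lens the inner bound has the dominant term, outside it the outer bound; for large [n]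
    the other term absorbs at most half of it. *)
Lemma cmod_Pn_lb z : cmod z < 1 -> z != 0 -> lens z != 0 ->
  exists2 c : R, 0 < c & exists N, forall n, (N <= n)%N ->
  c * Num.max (cmod (1 + z ^+ 2)) (2 * cmod z) ^+ n <=
  n.+1%:R ^+ 2 * cmod (Pn R n).[z].
Proof.
move=> z1 z0; have z1' := ltW z1.
have c0 (w : R[i]) : cmod w < 1 -> 0 < cmod (1 + w).
  move=> w1; rewrite cmod_gt0; apply: contraTneq w1 => /eqP.
  by rewrite addrC addr_eq0 => /eqP ->; rewrite cmodN cmod1 ltxx.
have A0 := cmod_ge0 (1 + z ^+ 2); have B0 := cmod_ge0 z.
rewrite neq_lt lens_lt0E// lens_gt0E// => /orP[AB|BA].
  rewrite max_r ?ltW//.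
  have [||D D0 [D1 D2]] :=
      @exists_double_le (cmod (1 - z) ^+ 2) (cmod (1 - z ^+ 2) ^+ 2).
  - by rewrite exprn_gt0// c0// cmodN.
  - by rewrite exprn_gt0// c0// cmodN cmodX expr_lt1.
  have E0 : 0 < cmod z * D by rewrite mulr_gt0// cmod_gt0.
  exists (cmod z * D / 4); first by rewrite divr_gt0.
  have [N HN] := geometric_le_geometric (8 / (cmod z * D)) 2 A0 AB.
  exists (maxn 1 N) => n; rewrite geq_max => /andP[n0 /HN].
  have := cmod_Pn_lb_outer n0 z1' D1 D2.
  move: (_ * D) E0 (_ ^+ n) (_ ^+ n) (cmod _.[_]) => E E0 Bn An p outer.
  rewrite -mulrA mulrAC ler_pdivrMr// => H.
  by move: outer; rewrite mulrDr; move: (_ ^+ 2) H => N2 H outer; nra.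
rewrite max_l ?ltW//.
exists (cmod (1 + z) / 2); first by rewrite divr_gt0 ?c0.
have [N HN] :=
  geometric_le_geometric (4 / cmod (1 + z)) 0 (mulr_ge0 (ler0n _ 2) B0) BA.
exists N => n /HN; rewrite expr0 mulr1 mulrAC ler_pdivrMr ?c0// => H.
have inner := cmod_Pn_lb_inner n z1'.
apply: le_trans (_ : cmod (Pn R n).[z] <= _); first lra.
by rewrite ler_peMl ?cmod_ge0// exprn_ege1// ler1n.
Qed.

End RootLocation.

(** * [Gamma] and its boundary in terms of [lens] *)

Section LensTopology.
Variable R : realType.
Implicit Types z w : R[i].

(** Radii of balls lie in [R[i]]; a positive one is real, hence given by its real part. *)
Lemma nbhs_cmodP z (U : set R[i]) :
  nbhs z U <-> exists2 e : R, 0 < e & forall w, cmod (z - w) < e -> U w.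
Proof.
split=> [/nbhs_ballP[e /= e0 zeU]|[e e0 zeU]].
  have ee : (complex.Re e)%:C%C = e by rewrite RRe_real// gtr0_real.
  exists (complex.Re e) => [|w zw]; first by rewrite -ltcR ee.
  by apply: zeU; rewrite -ball_normE /= -ee -cmodE ltcR.
apply/nbhs_ballP; exists e%:C%C => /=; first by rewrite ltcR.
by move=> w; rewrite -ball_normE /= -cmodE ltcR; exact: zeU.
Qed.

Lemma GammaE z : Gamma z <-> 0 <= lens z.
Proof.
split=> [[z1 /negPf Az]|tz].
  rewrite ler_pdivrMr ?cmod_gt0 ?Az// => le_zA.
  by rewrite leNgt lens_lt0E// -leNgt; lra.
have z1 := lens_ge0_cmod tz.
have le_BA : 2 * cmod z <= cmod (1 + z ^+ 2).
  by rewrite leNgt -lens_lt0E// -leNgt.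
have Az : 1 + z ^+ 2 != 0.
  apply: contraTneq le_BA => Az; rewrite Az cmod0 -ltNge mulr_gt0// cmod_gt0.
  by apply: contra_eq_neq Az => ->; rewrite expr0n addr0 oner_neq0.
by split=> //; rewrite ler_pdivrMr ?cmod_gt0//; lra.
Qed.

Lemma lens_lipschitz z w : cmod (z - w) <= 1 ->
  `|lens z - lens w| <= (2 * cmod z + 3) * cmod (z - w).
Proof.
move=> zw1.
have Im_le : `|complex.Im z - complex.Im w| <= cmod (z - w).
  rewrite -(ler_pXn2r (n := 2)) ?nnegrE ?cmod_ge0// real_normK ?num_real//.
  by rewrite cmod_sqr !reimE lerDr sqr_ge0.
have {Im_le} : `| `|complex.Im z| - `|complex.Im w| | <= cmod (z - w).
  exact: le_trans (ler_dist_dist _ _) Im_le.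
have h1 : cmod z <= cmod w + cmod (z - w).
  by rewrite (le_trans _ (cmod_leD _ _))// addrC subrK.
have h2 : cmod w <= cmod z + cmod (z - w).
  by rewrite cmod_distC (le_trans _ (cmod_leD _ _))// addrC subrK.
have := cmod_ge0 z; have := cmod_ge0 w; have := cmod_ge0 (z - w).
rewrite /lens !ler_norml; move: (cmod z) (cmod w) (cmod (z - w)) zw1 h1 h2.
move: `|_| `|_| => y v a b d *; apply/andP; split; nra.
Qed.

(** Where [lens] is nonzero, continuity fixes its sign nearby; where it vanishes, a small step away
    from the real axis makes it negative. *)
Lemma boundary_GammaE z : boundary (@Gamma R) z <-> lens z = 0.
Proof.
have near_lens z0 (e : R) : 0 < e -> exists2 d : R, 0 < d &
    forall w, cmod (z0 - w) < d -> `|lens z0 - lens w| < e.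
  move=> e0; have k0 : 0 < 2 * cmod z0 + 3 by have := cmod_ge0 z0; lra.
  exists (Num.min 1 (e / (2 * cmod z0 + 3))) => [|w].
    by rewrite lt_min ltr01 divr_gt0.
  rewrite lt_min ltr_pdivlMr// mulrC => /andP[/ltW w1 we].
  exact: le_lt_trans (lens_lipschitz w1) we.
split=> [[clz intz]|tz].
  apply/eqP; rewrite eq_le !leNgt; apply/andP; split; apply/negP => tz.
    apply: intz; apply/nbhs_cmodP; have [d d0 dP] := near_lens z _ tz.
    exists d => // w /dP; rewrite ltr_norml => /andP[_ tw].
    by apply/GammaE; lra.
  have [|d d0 dP] := near_lens z (- lens z); first by rewrite oppr_gt0.
  have [|w [/GammaE tw /dP]] := clz [set w | cmod (z - w) < d].
    by apply/nbhs_cmodP; exists d.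
  by rewrite ltr_norml => /andP[]; lra.
split; first by apply: subset_closure; apply/GammaE; rewrite tz.
move=> /nbhs_cmodP[e e0 eP]; case: z tz eP => x y tz eP.
pose v := if 0 <= y then y + e / 2 else y - e / 2.
have vE : `|v| = `|y| + e / 2.
  rewrite /v; case: ifPn => [y0|]; first by rewrite !ger0_norm//; lra.
  by rewrite -ltNge => y0; rewrite !ltr0_norm//; lra.
have /eP/GammaE : cmod ((x +i* y) - (x +i* v))%C < e.
  have -> : cmod ((x +i* y) - (x +i* v))%C = `|y - v|.
    by rewrite /= subrr expr0n add0r sqrtr_sqr.
  by rewrite /v; case: ifP => _; rewrite ltr_norml; apply/andP; split; lra.
move: tz; rewrite /lens !cmod_sqr /= -[v ^+ 2]real_normK ?num_real//.
rewrite -[y ^+ 2]real_normK ?num_real// vE.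
by have := mulr_ge0 (normr_ge0 y) (ltW e0); nra.
Qed.

End LensTopology.

(** * Convergence of the roots to the boundary *)

Section RootConvergence.
Variable R : realType.
Implicit Types z w : R[i].

Lemma root_Pn_near (e : R) : 0 < e ->
  exists N, forall n, (N <= n)%N -> forall z, root (Pn R n) z ->
  exists2 w, boundary (@Gamma R) w & cmod (z - w) <= e.
Proof.
move=> e0; have [N HN] := root_Pn_lens e0; exists N => n /HN{}HN z Pz.
have [z1|z1] := leP e (cmod (1 - z)); last first.
  exists 1; last by rewrite cmod_distC ltW.
  by apply/boundary_GammaE; rewrite lens1.
have [zN1|zN1] := leP e (cmod (1 + z)); last first.
  exists (- 1); last by rewrite opprK addrC ltW.
  by apply/boundary_GammaE; rewrite lensN1.
have [w [tw _ zw]] := lens_near (root_Pn_le1 Pz).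
by exists w; [apply/boundary_GammaE|exact: le_trans zw (HN _ Pz z1 zN1)].
Qed.

Lemma coef_Pn_deg n : (Pn R n)`_n != 0.
Proof.
rewrite /Pn coef_sum big_ord_recl coefZ coefXn subn0 eqxx mulr1 big1.
  by rewrite addr0 pnatr_eq0 -lt0n bin_gt0 subn0; lia.
move=> [i lt_in] _; rewrite coefZ coefXn /= /bump/=.
have -> : (n == n - (1 + i))%N = false by apply/eqP; lia.
by rewrite mulr0.
Qed.

Lemma size_Pn n : size (Pn R n) = n.+1.
Proof.
apply/eqP; rewrite eqn_leq; apply/andP; split; last first.
  by apply: contraR (coef_Pn_deg n); rewrite -ltnNge => ?; rewrite nth_default.
apply: (leq_trans (size_sum _ _ _)); apply/bigmax_leqP => i _.
by rewrite (leq_trans (size_scale_leq _ _))// size_polyXn ltnS leq_subr.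
Qed.

Lemma root_Pn_exists n : (0 < n)%N -> exists z, root (Pn R n) z.
Proof.
by move=> n0; apply/closed_rootP; rewrite size_Pn eqSS -lt0n.
Qed.

Lemma max_root_dist_cvg : max_root_dist R n @[n --> \oo] --> 0%E.
Proof.
have dist_ge0 z (A : set R[i]) : (0 <= dist z A)%E.
  by apply: le_ereal_inf_tmp => _ [w _ <-]; rewrite lee_fin cmod_ge0.
have mrd_ge0 n : (0 < n)%N -> (0 <= max_root_dist R n)%E.
  move=> /root_Pn_exists[z Pz].
  apply: le_trans (dist_ge0 z (boundary (@Gamma R))) _.
  by apply: ereal_sup_ubound; exists z.
have mrd_le (e : R) : 0 < e ->
    exists N, forall n, (N <= n)%N -> (max_root_dist R n <= e%:E)%E.
  move=> e0; have [N HN] := root_Pn_near e0; exists N => n /HN{}HN.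
  apply: ge_ereal_sup => _ [z /HN[w bw zw] <-].
  apply: le_trans (_ : (cmod (z - w))%:E <= _)%E; last by rewrite lee_fin.
  by apply: ereal_inf_lbound; exists w.
have [N1 HN1] := mrd_le 1 ltr01.
(* The value is [-oo] at [n = 0]; from [maxn 1 N1] on it lies between 0 and 1, so convergence can be
   checked on real numbers. *)
have finN n : (maxn 1 N1 <= n)%N ->
    (fine (max_root_dist R n))%:E = max_root_dist R n.
  rewrite geq_max => /andP[n0 /HN1 le1]; rewrite fineK// fin_numElt.
  by rewrite (lt_le_trans _ (mrd_ge0 _ n0)) ?ltNyr// (le_lt_trans le1) ?ltry.
apply: (@cvg_trans _ ((fine (max_root_dist R n))%:E @[n --> \oo])).
  apply: near_eq_cvg; exists (maxn 1 N1) => // n /=; exact: finN.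
apply: cvg_EFin; first by apply: nearW.
apply/cvgrPdist_le => e e0; have [N HN] := mrd_le _ e0.
exists (maxn N (maxn 1 N1)) => // n /=.
rewrite geq_max => /andP[/HN le_e /[dup] /finN].
rewrite geq_max => fE /andP[/mrd_ge0 ge0 _].
by rewrite sub0r normrN -lee_fin ger0_norm ?fE// -lee_fin fE.
Qed.

End RootConvergence.

(** * Density of the roots *)

Section DiscreteMeanValue.
Variable R : realType.
Implicit Types z w u : R[i].

Lemma prod_seq_const (F : comNzRingType) (I : Type) (s : seq I) (a : F) :
  \prod_(i <- s) a = a ^+ size s.
Proof. by rewrite big_const_seq count_predT iter_mulr_1. Qed.

(** The product formula is [x ^+ M - 1] at [x = a / u], made homogeneous so that it covers
    [u = 0]. *)
Lemma exists_unity_roots M : (0 < M)%N ->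
  exists rs : seq R[i], [/\ size rs = M, 1 \in rs,
    forall r, r \in rs -> cmod r = 1 &
    forall a u, \prod_(r <- rs) (a - u * r) = a ^+ M - u ^+ M].
Proof.
move=> M0; have [rs Drs] := closed_field_poly_normal ('X^M - 1 : {poly R[i]}).
rewrite (monicP (monicXnsubC _ M0)) scale1r in Drs.
have srs : size rs = M.
  by apply: succn_inj; rewrite -(size_prod_XsubC rs id) -Drs size_XnsubC.
have rsE x : \prod_(r <- rs) (x - r) = x ^+ M - 1.
  have <- : ('X^M - 1 : {poly R[i]}).[x] = x ^+ M - 1 by rewrite !hornerE.
  by rewrite Drs horner_prod; apply: eq_bigr => r _; rewrite hornerXsubC.
have rs_root x : (x \in rs) = (x ^+ M == 1).
  by rewrite -root_prod_XsubC -Drs rootE !hornerE subr_eq0.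
exists rs; split=> //.
- by rewrite rs_root expr1n.
- move=> r; rewrite rs_root => /eqP r1; apply/eqP.
  rewrite -(@pexpr_eq1 _ _ M) ?cmod_ge0//.
  by rewrite -cmodX r1 cmod1.
move=> a u; have [->|u0] := eqVneq u 0.
  rewrite expr0n gtn_eqF// subr0 -srs -(prod_seq_const rs).
  by apply: eq_bigr => r _; rewrite mul0r subr0.
have -> : a ^+ M - u ^+ M = u ^+ M * ((a / u) ^+ M - 1).
  by rewrite mulrBr mulr1 -exprMn mulrC divfK.
rewrite -rsE -srs -(prod_seq_const rs) -big_split/=.
by apply: eq_bigr => r _; rewrite mulrBr [u * (_ / _)]mulrC divfK.
Qed.

(** With [m = size rs], each root [z] of [p] contributes [(w - z)^m - u^m] to the product over the
    vertices, of modulus at most [|w - z|^m (1 + 2^-m)] as [2|u| <= |w - z|]; there are at most [n]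
    roots. *)
Lemma prod_rotations_le (p : {poly R[i]}) (rs : seq R[i]) n w u :
  (size p <= n.+1)%N -> p != 0 ->
  (forall a v, \prod_(r <- rs) (a - v * r) = a ^+ size rs - v ^+ size rs) ->
  (forall z, root p z -> 2 * cmod u <= cmod (w - z)) ->
  \prod_(r <- rs) cmod p.[w - u * r] <=
  cmod p.[w] ^+ size rs * (1 + 2^-1 ^+ size rs) ^+ n.
Proof.
move=> sp p0 rsE far; have [zs Dp] := closed_field_poly_normal p.
have lead0 : lead_coef p != 0 by rewrite lead_coef_eq0.
have zs_root z : z \in zs -> root p z.
  by rewrite Dp rootZ// root_prod_XsubC.
have szs : (size zs <= n)%N.
  by rewrite -ltnS -(size_prod_XsubC zs id) -(size_scale _ lead0) -Dp.
have pE x : p.[x] = lead_coef p * \prod_(z <- zs) (x - z).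
  rewrite {1}Dp hornerZ horner_prod; congr (_ * _).
  by apply: eq_bigr => z _; rewrite hornerXsubC.
set m := size rs in rsE *.
have -> : \prod_(r <- rs) cmod p.[w - u * r] =
    cmod (lead_coef p) ^+ m * \prod_(z <- zs) cmod ((w - z) ^+ m - u ^+ m).
  rewrite -!cmod_prod -cmodX -cmodM -(prod_seq_const rs); congr cmod.
  rewrite -(eq_bigr _ (fun z _ => rsE (w - z) u)).
  rewrite exchange_big -big_split/=; apply: eq_bigr => r _.
  by rewrite pE; congr (_ * _); apply: eq_bigr => z _; rewrite addrAC.
rewrite pE cmodM exprMn -mulrA ler_wpM2l ?exprn_ge0 ?cmod_ge0//.
apply: le_trans
  (_ : \prod_(z <- zs) (cmod (w - z) ^+ m * (1 + 2^-1 ^+ m)) <= _).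
  rewrite big_seq [leRHS]big_seq; apply: ler_prod => z /zs_root/far uz.
  rewrite cmod_ge0/= mulrDr mulr1 (le_trans (cmod_leD _ _))// cmodN !cmodX.
  rewrite lerD2l -exprMn lerXn2r ?nnegrE ?mulr_ge0 ?cmod_ge0//; lra.
rewrite big_split/= prodrXl -cmod_prod prod_seq_const.
rewrite ler_wpM2l ?exprn_ge0 ?cmod_ge0// ler_weXn2l// lerDl exprn_ge0//.
Qed.

Lemma prod_rotations_ge (rs : seq R[i]) w u :
  (forall a v, \prod_(r <- rs) (a - v * r) = a ^+ size rs - v ^+ size rs) ->
  2 * cmod u <= cmod w ->
  cmod w ^+ size rs * (1 - 2^-1 ^+ size rs) <= \prod_(r <- rs) cmod (w - u * r).
Proof.
move=> rsE uw; rewrite -cmod_prod rsE (le_trans _ (cmod_leB _ _))//.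
rewrite cmodN !cmodX mulrBr mulr1 lerD2l lerN2 -exprMn.
rewrite lerXn2r ?nnegrE ?mulr_ge0 ?cmod_ge0//.
lra.
Qed.

End DiscreteMeanValue.

(** * Roots near every boundary point *)

Section Density.
Variable R : realType.
Implicit Types z w u : R[i].

Lemma exists_notin (s : seq R) (a b : R) : a < b ->
  exists x, [/\ a < x, x < b & x \notin s].
Proof.
elim: s a b => [|h s IHs] a b ab.
  by exists ((a + b) / 2); split=> //; lra.
have [le_hm|lt_mh] := leP h ((a + b) / 2).
  have [|x [x1 x2 xs]] := IHs ((a + b) / 2) b; first lra.
  by exists x; split; rewrite ?inE ?negb_or ?xs ?andbT//; lra.
have [|x [x1 x2 xs]] := IHs a ((a + b) / 2); first lra.
by exists x; split; rewrite ?inE ?negb_or ?xs ?andbT//; lra.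
Qed.

Lemma prod_Pn_lb (zs : seq R[i]) :
  (forall z, z \in zs -> [/\ cmod z < 1, z != 0 & lens z != 0]) ->
  exists2 c : R, 0 < c & exists N, forall n, (N <= n)%N ->
  c * (\prod_(z <- zs) Num.max (cmod (1 + z ^+ 2)) (2 * cmod z)) ^+ n <=
  (n.+1%:R ^+ 2) ^+ size zs * \prod_(z <- zs) cmod (Pn R n).[z].
Proof.
elim: zs => [_|z zs IHzs zsP].
  by exists 1 => //; exists 0%N => n _; rewrite !big_nil expr1n expr0.
have [z1 z0 tz] := zsP z (mem_head _ _).
have [c c0 [N HN]] := cmod_Pn_lb z1 z0 tz.
have [|c' c'0 [N' HN']] := IHzs.
  by move=> y ys; apply: zsP; rewrite inE ys orbT.
exists (c * c'); first by rewrite mulr_gt0.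
exists (maxn N N') => n; rewrite geq_max => /andP[/HN le1 /HN' le2].
rewrite !big_cons exprMn mulrACA [_ ^+ size (_ :: _)]exprS [leRHS]mulrACA.
rewrite ler_pM//.
  by rewrite mulr_ge0 ?(ltW c0)// exprn_ge0// le_max cmod_ge0.
rewrite mulr_ge0 ?(ltW c'0)// exprn_ge0// prodr_ge0// => y _.
by rewrite le_max cmod_ge0.
Qed.

Lemma lens_gap z (e : R) : cmod z <= 1 -> 0 <= e -> e <= lens z ->
  2 * cmod z * (1 + e ^+ 2 / 8) <= cmod (1 + z ^+ 2).
Proof.
move=> z1 e0 te; apply: gap_of_sqr_gap.
- by have := cmod_ge0 z; lra.
- by rewrite cmod_ge0 cmod_1D_le2// sqr_cmod_le.
rewrite lens_factor; have := lens_cofactor z1; rewrite ler_norml => /andP[_].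
by move=> *; nra.
Qed.

(** As [sg] is the sign of [y], the vertex [r = 1] lies towards the real axis, inside the lens;
    [rho <= |y|] keeps all vertices on one side of that axis, which resolves the absolute value. *)
Lemma lens_vertex (x y sg rho : R) r :
  sg ^+ 2 = 1 -> sg * y = `|y| -> lens (x +i* y)%C = 0 -> cmod r = 1 ->
  0 <= rho <= `|y| ->
  lens ((x +i* y)%C - (0 +i* (sg * rho))%C * r) =
  rho * (2 * complex.Re r -
         2 * sg * (x * complex.Im r - y * complex.Re r) - rho).
Proof.
case: r => a b sg2 sgy tw r1 /andP[rho0 rho_y].
have r2 : a ^+ 2 + b ^+ 2 = 1.
  by have := cmod_sqr (a +i* b)%C; rewrite r1 expr1n.
have a1 : a <= 1 by rewrite -r1 (Re_le_cmod (a +i* b)%C).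
have -> : (x +i* y)%C - (0 +i* (sg * rho))%C * (a +i* b)%C =
    ((x + sg * rho * b) +i* (y - sg * rho * a))%C.
  apply/eqP; rewrite eq_complex !reimE /=.
  by apply/andP; split; apply/eqP; ring.
move: tw; rewrite /lens !cmod_sqr /=.
have -> : `|y - sg * rho * a| = `|y| - rho * a.
  have -> : y - sg * rho * a = sg * (`|y| - rho * a).
    by rewrite -sgy mulrBr mulrA -expr2 sg2; ring.
  have sg1 : `|sg| = 1.
    by apply/eqP; rewrite -(@pexpr_eq1 _ _ 2)// real_normK ?num_real// sg2.
  by rewrite normrM sg1 mul1r ger0_norm//; nra.
rewrite -sgy => tw.
have -> : (x + sg * rho * b) ^+ 2 + (y - sg * rho * a) ^+ 2 =
    x ^+ 2 + y ^+ 2 + 2 * rho * sg * (x * b - y * a) +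
    sg ^+ 2 * rho ^+ 2 * (a ^+ 2 + b ^+ 2) by ring.
rewrite sg2 r2; apply/eqP; rewrite -subr_eq0 -[X in _ == X]tw.
by apply/eqP; ring.
Qed.

(* If [Pn R n] had no root near [w], the product of its values at the vertices
   of a regular polygon centered at [w] would be at most [cmod (Pn R n).[w]^M]
   up to a factor [(1 + 2 ^- M) ^+ n].  One vertex lies inside the lens, where
   [Pn R n] is exponentially larger than [(2 * cmod z) ^+ n]; the radius is
   chosen so that no vertex lies on the boundary.  *)
Lemma root_Pn_dense_off_corners w (eps : R) :
  lens w = 0 -> cmod w < 1 -> 0 < eps ->
  exists N, forall n, (N <= n)%N ->
  exists2 z, root (Pn R n) z & cmod (z - w) <= eps.
Proof.
case: w => x y tw w1 eps0.
have w2 : x ^+ 2 + y ^+ 2 < 1.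
  by have := w1; rewrite -(@expr_lt1 _ 2) ?cmod_ge0// cmod_sqr.
have y0 : y != 0.
  apply/eqP => y0; move: tw w2.
  by rewrite /lens cmod_sqr /= y0 normr0; lra.
pose sg : R := Num.sg y.
have sg2 : sg ^+ 2 = 1 by rewrite sqr_sg y0.
have sgy : sg * y = `|y| by rewrite [RHS]normrEsg.
have ny0 : 0 < `|y| by rewrite normr_gt0.
(* For a radius below [e] the polygon stays in the open unit disk and away from 0, and roots farther
   than [eps] from the center satisfy the distance condition of [prod_rotations_le]. *)
have [e [e0 e1 e2 e3]] : exists e : R,
    [/\ 0 < e, 2 * e <= eps, 2 * e <= 1 - cmod (x +i* y)%C & 2 * e <= `|y| ].
  pose m := Num.min (Num.min eps (1 - cmod (x +i* y)%C)) `|y|.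
  exists (m / 2); rewrite [2 * _]mulrC divfK// !ge_min !lexx !orbT divr_gt0//.
  by rewrite !lt_min eps0 ny0 subr_gt0 w1.
(* The relative gain that [lens_gap] gives at a vertex with [lens] at least [e / 2]. *)
pose d := (e / 2) ^+ 2 / 8.
have d0 : 0 < d by rewrite divr_gt0// exprn_gt0// divr_gt0.
have d1 : d < 1.
  have : e < 1 by have := cmod_ge0 (x +i* y)%C; lra.
  by rewrite /d; nra.
(* With [2 ^+ M >= 4 / d], the gain [1 + d] at one vertex beats the loss
   [(1 + theta) / (1 - theta)], where [theta = 2 ^- M]. *)
have [M0 /(_ M0.+1 (leqnSn _))] :=
  @polynomial_le_geometric R 2 (4 / d) 0 (ltr1n _ 2).
rewrite expr0 mulr1; set M := M0.+1 => dM.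
have [rs [srs rs1 rs_norm rsE]] := @exists_unity_roots R M (ltn0Sn _).
rewrite -srs in rsE.
pose bad (r : R[i]) :=
  2 * complex.Re r - 2 * sg * (x * complex.Im r - y * complex.Re r).
(* By [lens_vertex], the vertex of [r] lies on the boundary only for the radius [bad r]. *)
have [|rho [rho1 rho2 rho_bad]] := @exists_notin (map bad rs) (e / 2) e.
  lra.
pose u : R[i] := (0 +i* (sg * rho))%C.
have cu : cmod u = rho.
  by rewrite /= expr0n add0r exprMn sg2 mul1r sqrtr_sqr ger0_norm//; lra.
have yw : `|y| <= cmod (x +i* y)%C.
  rewrite -(ler_pXn2r (n := 2)) ?nnegrE ?cmod_ge0// cmod_sqr.
  by rewrite real_normK ?num_real// lerDr sqr_ge0.
have lens_pt r : r \in rs ->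
    lens ((x +i* y)%C - u * r) = rho * (bad r - rho).
  move=> r_rs; apply: lens_vertex; rewrite ?rs_norm//=.
  by apply/andP; split; lra.
move: tw w1 w2 e2 yw lens_pt; set w := (x +i* y)%C => tw w1 w2 e2 yw lens_pt.
have w0 : 0 < cmod w by lra.
pose pts := [seq w - u * r | r <- rs].
have pts_le r : r \in rs -> cmod w - rho <= cmod (w - u * r) <= cmod w + rho.
  move=> r_rs; have ur : cmod (- (u * r)) = rho.
    by rewrite cmodN cmodM cu rs_norm// mulr1.
  by rewrite -{1}ur cmod_leB/= -[X in _ <= _ + X]ur cmod_leD.
have [|c c0 [N1 HN1]] := @prod_Pn_lb pts.
  move=> _ /mapP[r r_rs ->]; have /andP[le1 le2] := pts_le r r_rs.
  split; [lra|by rewrite -cmod_gt0; lra|].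
  rewrite lens_pt// mulf_neq0//; first by rewrite gt_eqF//; lra.
  by rewrite subr_eq0; apply: contraNneq rho_bad => <-; rewrite map_f.
pose D z := Num.max (cmod (1 + z ^+ 2)) (2 * cmod z).
pose theta : R := 2^-1 ^+ M.
have theta0 : 0 < theta by rewrite exprn_gt0.
have theta_d : 4 * theta <= d.
  move: dM; rewrite ler_pdivrMr// /theta exprVn ler_pdivrMr ?exprn_gt0//.
  by rewrite mulrC.
have inside : (1 + d) * (2 * cmod (w - u)) <= D (w - u).
  rewrite /D le_max; apply/orP; left; rewrite mulrC.
  have := pts_le 1 rs1; rewrite mulr1 => /andP[_ le_wu].
  have wu1 : cmod (w - u) <= 1 by lra.
  have := lens_pt 1 rs1; rewrite mulr1 /bad /= => tE.
  have te : e / 2 <= lens (w - u).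
    rewrite tE mulr1 mulr0 sub0r mulr1.
    have -> : 2 - 2 * sg * - y = 2 + 2 * (sg * y) by ring.
    rewrite sgy (le_trans (ltW rho1))// ler_peMr; lra.
  by apply: (lens_gap wu1 _ te); rewrite divr_ge0// ltW.
(* Only the vertex [r = 1] uses the gain; at the others [D z >= 2|z|] suffices. *)
have X_ge : (1 + d) * (2 * cmod w) ^+ M * (1 - theta) <= \prod_(z <- pts) D z.
  apply: le_trans (_ : (1 + d) * \prod_(r <- rs) (2 * cmod (w - u * r)) <= _).
    rewrite -mulrA ler_wpM2l//; first lra.
    rewrite big_split/= prod_seq_const srs exprMn -mulrA ler_wpM2l ?exprn_ge0//.
    have := @prod_rotations_ge R rs w u rsE; rewrite srs; apply.
    by rewrite cu; lra.
  rewrite big_map !(perm_big _ (perm_to_rem rs1))/= !big_cons mulr1 mulrA.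
  apply: ler_pM => //.
  - by rewrite !mulr_ge0 ?cmod_ge0//; lra.
  - by apply: prodr_ge0 => r _; rewrite mulr_ge0 ?cmod_ge0.
  by apply: ler_prod => r _; rewrite mulr_ge0 ?cmod_ge0//= le_max lexx orbT.
pose Y := (2 * cmod w) ^+ M * (1 + theta).
have Y0 : 0 < Y by rewrite mulr_gt0 ?exprn_gt0 ?mulr_gt0//; lra.
have YX : Y < \prod_(z <- pts) D z.
  apply: lt_le_trans X_ge.
  rewrite mulrAC mulrC /Y ltr_pM2l ?exprn_gt0 ?mulr_gt0//.
  by nra.
(* The factor 2 contradicts [c * X ^+ n <= n.+1%:R ^+ (2 * M) * 4 ^+ M * Y ^+ n], with [X] the
   product of the [D z], which the absence of nearby roots implies. *)
have [N2 HN2] := geometric_le_geometric (2 * 4 ^+ M / c) (2 * M) (ltW Y0) YX.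
exists (maxn N1 N2) => n; rewrite geq_max => /andP[/HN1 lower /HN2 gap].
apply: contrapT => noroot.
have : c * (\prod_(z <- pts) D z) ^+ n <=
    (n.+1%:R ^+ 2) ^+ M * (4 ^+ M * Y ^+ n).
  apply: le_trans lower _; rewrite size_map srs ler_wpM2l ?exprn_ge0//.
  rewrite big_map.
  have sP : (size (Pn R n) <= n.+1)%N by rewrite size_Pn.
  have P0 : Pn R n != 0 by rewrite -size_poly_eq0 size_Pn.
  have far z : root (Pn R n) z -> 2 * cmod u <= cmod (w - z).
    move=> Pz; rewrite cu; have [le_e|] := leP (cmod (z - w)) eps.
      by exfalso; apply: noroot; exists z.
    by rewrite cmod_distC; lra.
  have := prod_rotations_le sP P0 rsE far; rewrite srs => /le_trans; apply.
  rewrite /Y exprMn mulrA ler_wpM2r ?exprn_ge0//.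
  rewrite exprAC -exprMn lerXn2r ?nnegrE ?cmod_ge0 ?mulr_ge0 ?exprn_ge0//.
    by rewrite mulr_ge0 ?cmod_ge0.
  (* On the curve [|1 + w^2| = 2|w|], so both terms of the upper bound merge into [4 (2|w|)^n]. *)
  have := cmod_Pn_ub n (ltW w1).
  have -> : cmod (1 + w ^+ 2) = 2 * cmod w.
    apply/eqP; rewrite -(eqrXn2 (n := 2)) ?cmod_ge0 ?mulr_ge0 ?cmod_ge0//.
    by rewrite -subr_eq0 lens_factor tw mul0r.
  by move/le_trans; apply; lra.
have Yn : 0 < Y ^+ n by rewrite exprn_gt0.
move: gap; rewrite exprM.
have N0 : 0 < (n.+1%:R ^+ 2) ^+ M :> R by rewrite !exprn_gt0.
have M4 : 0 < 4 ^+ M :> R by rewrite exprn_gt0.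
move: (_ ^+ 2 ^+ M) (4 ^+ M) (Y ^+ n) ((\prod_(z <- pts) D z) ^+ n) N0 M4 Yn.
move=> N q Yn Xn N0 q0 Yn0 gap le_c.
have : 0 < N * (q * Yn) by rewrite !mulr_gt0.
have : 2 * (N * (q * Yn)) <= c * Xn.
  apply: le_trans (ler_wpM2l (ltW c0) gap).
  rewrite le_eqVlt; apply/orP; left; apply/eqP; field; rewrite gt_eqF//.
lra.
Qed.

(** A boundary point of modulus 1 is a corner, 1 or -1; it is replaced by a boundary point of
    smaller modulus within [eps / 2]. *)
Lemma root_Pn_dense w (eps : R) : boundary (@Gamma R) w -> 0 < eps ->
  exists N, forall n, (N <= n)%N ->
  exists z, root (Pn R n) z /\ cmod (z - w) <= eps.
Proof.
move=> /boundary_GammaE tw eps0.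
have w1 : cmod w <= 1 by apply: lens_ge0_cmod; rewrite tw.
have [v tv [v1 wv]] : exists2 v, lens v = 0 &
    cmod v < 1 /\ cmod (v - w) <= eps / 2.
  (* The point [(1 - d) w] is at distance [d] from [w], and [lens_near] costs at most [2 * d] more:
     [3 * d <= eps / 2]. *)
  pose d := Num.min 1 eps / 6.
  have d0 : 0 < d by rewrite divr_gt0// lt_min ltr01.
  have [d1 de] : 6 * d <= 1 /\ 6 * d <= eps.
    by rewrite /d [6 * _]mulrC divfK// !ge_min !lexx orbT.
  have [w1'|w_lt1] := leP 1 (cmod w); last first.
    by exists w => //; split; rewrite // subrr cmod0; lra.
  have {w1'}w1 : cmod w = 1 by apply/eqP; rewrite eq_le w1.
  have Imw : complex.Im w = 0.
    by apply/normr0_eq0; move: tw; rewrite /lens w1; lra.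
  have Rew : complex.Re w ^+ 2 = 1.
    by have := cmod_sqr w; rewrite w1 Imw expr1n expr0n addr0 => <-.
  pose z := (1 - d)%:C%C * w.
  have cd (k : R) : 0 <= k -> cmod k%:C%C = k.
    by move=> k0; rewrite /= expr0n addr0 sqrtr_sqr ger0_norm.
  have cz : cmod z = 1 - d by rewrite cmodM w1 mulr1 cd//; lra.
  have tz : `|lens z| <= 2 * d.
    have -> : lens z = 2 * d - d ^+ 2.
      by rewrite /lens cz /z complex_ImM Imw /= mulr0 mul0r addr0 normr0; ring.
    by rewrite ger0_norm; nra.
  have [|v [tv Rev zv]] := @lens_near R z; first by rewrite cz; lra.
  exists v => //; split.
    have : cmod v <= 1 by apply: lens_ge0_cmod; rewrite tv.
    rewrite le_eqVlt => /predU1P[v1|//].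
    have Imv : complex.Im v = 0.
      by apply/normr0_eq0; move: tv; rewrite /lens v1; lra.
    have := cmod_sqr v; rewrite v1 Imv expr1n expr0n addr0 Rev /z.
    by rewrite complex_ReM /= mul0r subr0 exprMn Rew mulr1; nra.
  have -> : v - w = (v - z) + (z - w) by rewrite addrA subrK.
  rewrite (le_trans (cmod_leD _ _))// cmod_distC.
  have -> : z - w = - (d%:C%C * w).
    by rewrite /z rmorphB/= rmorph1; ring.
  by rewrite cmodN cmodM w1 mulr1 cd; lra.
have [N HN] := root_Pn_dense_off_corners tv v1 (divr_gt0 eps0 (ltr0n _ 2)).
exists N => n /HN[z Pz zv]; exists z; split=> //.
have -> : z - w = (z - v) + (v - w) by rewrite addrA subrK.
by rewrite (le_trans (cmod_leD _ _))//; lra.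
Qed.

End Density.

Theorem theorem5p4 (R : realType) :
  (max_root_dist R n @[n --> \oo] --> 0%E) /\
  (forall w : R[i], boundary (@Gamma R) w ->
   forall eps : R, 0 < eps ->
   exists N : nat, forall n : nat, (N <= n)%N ->
   exists zeta : R[i], root (Pn R n) zeta /\ cmod (zeta - w) <= eps).
Proof.
split; first exact: max_root_dist_cvg.
by move=> w bw eps eps0; exact: root_Pn_dense.
Qed.
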